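(* The quotient semigroup $\mathbf{ID}_{\infty}/\mathfrak{C}_{\mathsf{mg}}$ is isomorphic to the group $\mathrm{Iso}(\mathbb{Z})$ of all isometries of $\mathbb{Z}$; moreover, the natural homomorphism $\mathfrak{C}_{\mathsf{mg}}^{\natural}\colon \mathbf{ID}_{\infty}\to \mathrm{Iso}(\mathbb{Z})$ is given by $\alpha\mapsto\gamma_\alpha$, where $\gamma_\alpha$ is the unique element of the group of units $H(1)=\mathrm{Iso}(\mathbb{Z})$ of $\mathbf{ID}_{\infty}$ such that $\alpha\leqslant\gamma_\alpha$.
   Context: A partial cofinite isometry of the set of integers $\mathbb{Z}$ is a partial map $\alpha\colon\mathbb{Z}\rightharpoonup\mathbb{Z}$ such that $\mathbb{Z}\setminus\operatorname{dom}\alpha$ and $\mathbb{Z}\setminus\operatorname{ran}\alpha$ are finite and $|(x)\alpha-(y)\alpha|=|x-y|$ for all $x,y\in\operatorname{dom}\alpha$. $\mathbf{ID}_{\infty}$ is the semigroup of all partial cofinite isometries of $\mathbb{Z}$ under composition of partial maps; maps are written on the right, so $(x)(\alpha\beta)=((x)\alpha)\beta$ with domain $\{x\in\operatorname{dom}\alpha\colon (x)\alpha\in\operatorname{dom}\beta\}$. It is an inverse monoid with identity $1=\mathrm{id}_{\mathbb{Z}}$, and its group of units $H(1)$ is the group $\mathrm{Iso}(\mathbb{Z})$ of all isometries of $\mathbb{Z}$. The natural partial order on an inverse semigroup $S$: $s\leqslant t$ iff $s=te$ for some idempotent $e\in S$. The least group congruence $\mathfrak{C}_{\mathsf{mg}}$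 on an inverse semigroup $S$: $s\,\mathfrak{C}_{\mathsf{mg}}\,t$ iff there is an idempotent $e\in S$ with $es=et$. *)

(* Defs.v *)
From HB Require Import structures.
From mathcomp Require Import all_boot order ssralg ssrnum ssrint.
From mathcomp Require Import boolp classical_sets functions cardinality.

Set Implicit Arguments.
Unset Strict Implicit.
Unset Printing Implicit Defensive.

Import Order.TTheory GRing.Theory Num.Theory.

Local Open Scope classical_set_scope.
Local Open Scope group_scope.
Local Open Scope quotient_scope.

Definition idempotent_elt (S : semigroupType) (e : S) : Prop := e * e = e.

Definition inverse_of (S : semigroupType) (x y : S) : Prop :=
  x * y * x = x /\ y * x * y = y.

HB.mixin Record Semigroup_isInverse S of Semigroup S := {
  inverse_uniq : forall x : S, exists! y : S, inverse_of x y
}.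

#[short(type="inverseSemigroupType")]
HB.structure Definition InverseSemigroup :=
  {S of Semigroup_isInverse S & Semigroup S}.

(* The natural partial order of an inverse semigroup. *)
Definition natural_le (S : semigroupType) (s t : S) : Prop :=
  exists2 e : S, idempotent_elt e & s = t * e.

Definition group_of_units (M : monoidType) : set M :=
  [set u | exists v : M, u * v = 1 /\ v * u = 1].
Arguments group_of_units M : clear implicits.

Section LeastGroupCongruence.
Variable S : inverseSemigroupType.
Implicit Types s t u e f : S.

(* The least group congruence of an inverse semigroup. *)
Definition mg_cong s t : Prop :=
  exists2 e : S, idempotent_elt e & e * s = e * t.

Lemma inverse_of_inj s t u : inverse_of s t -> inverse_of s u -> t = u.
Proof. by move=> st su; have [v [_ h]] := inverse_uniq s; rewrite -(h t) ?(h u). Qed.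

Lemma idempotent_inverse_of e : idempotent_elt e -> inverse_of e e.
Proof. by move=> ee; split; rewrite !ee. Qed.

Lemma idempotent_mul e f :
  idempotent_elt e -> idempotent_elt f -> idempotent_elt (e * f).
Proof.
move=> ee ff; have [x [[h1 h2] _]] := inverse_uniq (e * f).
have fxeI : inverse_of (e * f) (f * x * e).
  split; rewrite !mulgA.
    by rewrite -[e * f * f]mulgA ff -[e * f * x * e * e]mulgA ee -mulgA h1.
  rewrite -[f * x * e * e]mulgA ee -[f * x * e * f * f]mulgA ff.
  by rewrite -[RHS](congr1 (fun z => f * z * e) h2) !mulgA.
have xE : x = f * x * e := inverse_of_inj (conj h1 h2) fxeI.
have xx : idempotent_elt x.
  rewrite /idempotent_elt {1 2}xE.
  by rewrite [RHS]xE -[in RHS]h2 !mulgA.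
by rewrite (inverse_of_inj (_ : inverse_of x (e * f)) (idempotent_inverse_of xx)).
Qed.

Lemma idempotent_comm e f :
  idempotent_elt e -> idempotent_elt f -> e * f = f * e.
Proof.
move=> ee ff; have ef := idempotent_mul ee ff; have fe := idempotent_mul ff ee.
apply: (inverse_of_inj (idempotent_inverse_of ef)); split; rewrite !mulgA.
  by rewrite -[e * f * f]mulgA ff -[e * f * e * e]mulgA ee -mulgA ef.
by rewrite -[f * e * e]mulgA ee -[f * e * f * f]mulgA ff -mulgA fe.
Qed.

Definition mg_rel : rel S := fun s t => `[< mg_cong s t >].

Lemma mg_rel_refl : reflexive mg_rel.
Proof.
move=> s; apply/asboolP; have [x [[h1 h2] _]] := inverse_uniq s.
by exists (s * x); rewrite // /idempotent_elt mulgA h1.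
Qed.

Lemma mg_rel_sym : symmetric mg_rel.
Proof. by move=> s t; apply/asboolP/asboolP => -[e ee es]; exists e. Qed.

Lemma mg_rel_trans : transitive mg_rel.
Proof.
move=> t s u /asboolP[e ee est] /asboolP[f ff ftu]; apply/asboolP.
exists (f * e); first exact: idempotent_mul.
by rewrite -mulgA est mulgA -(idempotent_comm ee ff) -mulgA ftu mulgA.
Qed.

Canonical mg_equiv : equiv_rel S :=
  EquivRel mg_rel mg_rel_refl mg_rel_sym mg_rel_trans.

Definition mg_quot : Type := {eq_quot mg_equiv}.
HB.instance Definition _ := EqQuotient.on mg_quot.
HB.instance Definition _ := Choice.on mg_quot.

Lemma mg_piP s t : reflect (mg_cong s t) (\pi_mg_quot s == \pi_mg_quot t).
Proof. by rewrite eqmodE; apply: asboolP. Qed.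

Lemma mg_congM s s' t t' :
  mg_cong s s' -> mg_cong t t' -> mg_cong (s * t) (s' * t').
Proof.
move=> [e ee es] [f ff ft].
have : mg_rel (s * t) (s * t').
  apply/asboolP; have [x [[h1 h2] _]] := inverse_uniq s.
  have xs : idempotent_elt (x * s) by rewrite /idempotent_elt mulgA h2.
  have sf : s * f * x * s = s * f.
    by rewrite -[s * f * x * s]mulgA -mulgA (idempotent_comm ff xs) !mulgA h1.
  exists (s * f * x).
    by rewrite /idempotent_elt !mulgA sf -[s * f * f]mulgA ff.
  by rewrite !mulgA sf -!mulgA ft.
move=> /mg_rel_trans h; apply/asboolP; apply: h; apply/asboolP.
by exists e; rewrite // !mulgA es.
Qed.

Definition mg_quot_mul : mg_quot -> mg_quot -> mg_quot :=
  lift_op2 mg_quot (fun s t : S => s * t).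

Lemma pi_mg_mul :
  {morph \pi_mg_quot : s t / s * t >-> mg_quot_mul s t}.
Proof.
move=> s t; unlock mg_quot_mul; apply/eqP/mg_piP.
by apply: mg_congM; apply/mg_piP; rewrite reprK.
Qed.

Lemma mg_quot_mulA : associative mg_quot_mul.
Proof.
by elim/quotW=> s; elim/quotW=> t; elim/quotW=> u; rewrite -!pi_mg_mul mulgA.
Qed.

HB.instance Definition _ := isSemigroup.Build mg_quot mg_quot_mulA.

(* The natural homomorphism onto the quotient. *)
Definition mg_natural (s : S) : mg_quot := \pi_mg_quot s.
HB.instance Definition _ := isMultiplicative.Build S mg_quot mg_natural pi_mg_mul.

End LeastGroupCongruence.

Arguments mg_natural {S} s.

(* Partial maps of the integers are functions [int -> option int], with [None]
   outside the domain. *)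
Definition pdom (f : int -> option int) : set int := [set x | isSome (f x)].
Definition pran (f : int -> option int) : set int :=
  [set y | exists x, f x = Some y].

Definition partial_isometry (f : int -> option int) : Prop :=
  forall x y x' y', f x = Some x' -> f y = Some y' ->
  (`|x' - y'| = `|x - y|)%R.

Record ID : Type := MkID {
  ID_fun :> int -> option int;
  ID_cofin_dom : finite_set (~` pdom ID_fun);
  ID_cofin_ran : finite_set (~` pran ID_fun);
  ID_isom : partial_isometry ID_fun
}.

HB.instance Definition _ := gen_eqMixin ID.
HB.instance Definition _ := gen_choiceMixin ID.

Lemma ID_ext (a b : ID) : a =1 b -> a = b.
Proof.
case: a b => [f f1 f2 f3] [g g1 g2 g3] /= /funext fg; subst g.
by congr MkID; exact: Prop_irrelevance.
Qed.

Lemma ID_inj (a : ID) x y z : a x = Some z -> a y = Some z -> x = y.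
Proof.
move=> ax ay; have /eqP := ID_isom ax ay.
by rewrite subrr normr0 eq_sym normr_eq0 subr_eq0 => /eqP.
Qed.

Definition pinv (f : int -> option int) (y : int) : option int :=
  if pselect (exists x, f x == Some y) is left h then Some (xchoose h)
  else None.

Lemma pinvP (a : ID) x y : pinv a y = Some x <-> a x = Some y.
Proof.
rewrite /pinv; case: pselect => [h|h]; last first.
  by split=> // axy; case: h; exists x; apply/eqP.
have /eqP ay := xchooseP h.
by split=> [[<-]//|axy]; rewrite (ID_inj ay axy).
Qed.

(* Maps act on the right: in [a * b] the map [a] is applied first. *)
Definition ID_comp (f g : int -> option int) (x : int) : option int :=
  obind g (f x).

Lemma ID_comp_dom (a b : ID) : finite_set (~` pdom (ID_comp a b)).
Proof.
apply: (@sub_finite_set _ _ (~` pdom a `|`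
   (fun y => odflt 0%R (pinv a y)) @` (~` pdom b))).
  move=> x; rewrite /pdom /ID_comp /=; case E: (a x) => [y|] /= h; last by left.
  by right; exists y => //; rewrite (pinvP a x y).2.
rewrite finite_setU; split; first exact: ID_cofin_dom.
exact/finite_image/ID_cofin_dom.
Qed.

Lemma ID_comp_ran (a b : ID) : finite_set (~` pran (ID_comp a b)).
Proof.
apply: (@sub_finite_set _ _ (~` pran b `|`
   (fun y => odflt 0%R (b y)) @` (~` pran a))).
  move=> z zab; have [[y byz]|] := pselect (pran b z); last by left.
  right; exists y; last by rewrite byz.
  by move=> [x axy]; apply: zab; exists x; rewrite /ID_comp axy.
rewrite finite_setU; split; first exact: ID_cofin_ran.
exact/finite_image/ID_cofin_ran.
Qed.

Lemma ID_comp_isom (a b : ID) : partial_isometry (ID_comp a b).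
Proof.
move=> x y x' y'; rewrite /ID_comp.
case ax: (a x) => [u|] //= bu; case ay: (a y) => [v|] //= bv.
by rewrite (ID_isom bu bv) (ID_isom ax ay).
Qed.

Definition ID_mul (a b : ID) : ID :=
  MkID (ID_comp_dom a b) (ID_comp_ran a b) (@ID_comp_isom a b).

Lemma total_dom (f : int -> int) : finite_set (~` pdom (fun x => Some (f x))).
Proof. by rewrite (_ : pdom _ = setT) ?setCT //; apply/seteqP; split. Qed.

Lemma total_ran (f : int -> int) :
  bijective f -> finite_set (~` pran (fun x => Some (f x))).
Proof.
move=> [g _ gK]; rewrite (_ : pran _ = setT) ?setCT //; apply/seteqP; split=> //.
by move=> y _; exists (g y); rewrite gK.
Qed.

Lemma id_isom : partial_isometry Some.
Proof. by move=> x y x' y' [->] [->]. Qed.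

Definition ID_one : ID :=
  @MkID Some (total_dom id) (total_ran (Bijective (fun=> erefl) (fun=> erefl)))
        id_isom.

Lemma ID_mulA : associative ID_mul.
Proof.
by move=> a b c; apply: ID_ext => x; rewrite /= /ID_comp /= /ID_comp; case: (a x).
Qed.

Lemma ID_mul1 : left_id ID_one ID_mul.
Proof. by move=> a; apply: ID_ext. Qed.

Lemma ID_mulr1 : right_id ID_one ID_mul.
Proof. by move=> a; apply: ID_ext => x /=; rewrite /ID_comp; case: (a x). Qed.

HB.instance Definition _ := isMonoid.Build ID ID_mulA ID_mul1 ID_mulr1.

Lemma pinv_dom (a : ID) : finite_set (~` pdom (pinv a)).
Proof.
apply: sub_finite_set (ID_cofin_ran a) => y; rewrite /pdom /= => h [x ax].
by apply: h; rewrite (pinvP a x y).2.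
Qed.

Lemma pinv_ran (a : ID) : finite_set (~` pran (pinv a)).
Proof.
apply: sub_finite_set (ID_cofin_dom a) => x h /=; rewrite /pdom /=.
by case E: (a x) => [y|] // _; apply: h; exists y; apply/pinvP.
Qed.

Lemma pinv_isom (a : ID) : partial_isometry (pinv a).
Proof. by move=> x y x' y' /pinvP h /pinvP k; rewrite (ID_isom h k). Qed.

Definition ID_inv (a : ID) : ID :=
  MkID (pinv_dom a) (pinv_ran a) (@pinv_isom a).

Lemma ID_inverse_of_graph (a b : ID) :
  a * b * a = a -> forall x y, a x = Some y -> b y = Some x.
Proof.
move=> aba x y axy; have : (a * b * a) x = Some y by rewrite aba.
rewrite /= /ID_comp /= /ID_comp axy /=; case: (b y) => //= x' ax'.
by rewrite (ID_inj ax' axy).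
Qed.

Lemma ID_inverse_uniq (a : ID) : exists! b : ID, inverse_of a b.
Proof.
exists (ID_inv a); split.
  split; apply: ID_ext => x; rewrite /= /ID_comp /= /ID_comp /=.
    by case E: (a x) => [y|] //=; rewrite (pinvP a x y).2.
  by case E: (pinv a x) => [y|] //=; rewrite ((pinvP a y x).1 E).
move=> b [/ID_inverse_of_graph ab /ID_inverse_of_graph ba].
apply: ID_ext => y /=; case E: (pinv a y) => [x|].
  by move/pinvP: E => /ab.
by case F: (b y) => [x|] //; move/ba: F => /pinvP; rewrite E.
Qed.

HB.instance Definition _ := Semigroup_isInverse.Build ID ID_inverse_uniq.

(* Isometries are bijective by definition; for the integers distance
   preservation alone would already imply it. *)
Record isoZ : Type := MkIsoZ {
  iso_fun :> int -> int;
  iso_bij : bijective iso_fun;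
  iso_dist : forall x y, (`|iso_fun x - iso_fun y| = `|x - y|)%R
}.

HB.instance Definition _ := gen_eqMixin isoZ.
HB.instance Definition _ := gen_choiceMixin isoZ.

Lemma isoZ_ext (f g : isoZ) : f =1 g -> f = g.
Proof.
case: f g => [f f1 f2] [g g1 g2] /= /funext fg; subst g.
by congr MkIsoZ; exact: Prop_irrelevance.
Qed.

Lemma isoZ_surj (f : isoZ) y : exists x, f x == y.
Proof. by have [g _ gK] := iso_bij f; exists (g y); rewrite gK. Qed.

Definition isoZ_inv_fun (f : isoZ) (y : int) : int := xchoose (isoZ_surj f y).

Lemma isoZ_invKV (f : isoZ) : cancel (isoZ_inv_fun f) f.
Proof. by move=> y; apply/eqP/(xchooseP (isoZ_surj f y)). Qed.

Lemma isoZ_invK (f : isoZ) : cancel f (isoZ_inv_fun f).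
Proof. by move=> x; apply: (bij_inj (iso_bij f)); rewrite isoZ_invKV. Qed.

Lemma isoZ_inv_dist (f : isoZ) x y :
  (`|isoZ_inv_fun f x - isoZ_inv_fun f y| = `|x - y|)%R.
Proof. by rewrite -(iso_dist f) !isoZ_invKV. Qed.

Definition isoZ_inv (f : isoZ) : isoZ :=
  MkIsoZ (Bijective (isoZ_invKV f) (isoZ_invK f)) (isoZ_inv_dist f).

Definition isoZ_one : isoZ :=
  @MkIsoZ id (Bijective (fun=> erefl) (fun=> erefl)) (fun _ _ => erefl).

Lemma isoZ_mul_dist (f g : isoZ) x y :
  (`|(g \o f) x - (g \o f) y| = `|x - y|)%R.
Proof. by rewrite /= !iso_dist. Qed.

(* Maps act on the right here as well. *)
Definition isoZ_mul (f g : isoZ) : isoZ :=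
  MkIsoZ (bij_comp (iso_bij g) (iso_bij f)) (isoZ_mul_dist f g).

Lemma isoZ_mulA : associative isoZ_mul.
Proof. by move=> f g h; apply: isoZ_ext. Qed.
Lemma isoZ_mul1 : left_id isoZ_one isoZ_mul.
Proof. by move=> f; apply: isoZ_ext. Qed.
Lemma isoZ_mulr1 : right_id isoZ_one isoZ_mul.
Proof. by move=> f; apply: isoZ_ext. Qed.
Lemma isoZ_mulV : left_inverse isoZ_one isoZ_inv isoZ_mul.
Proof. by move=> f; apply: isoZ_ext => x; apply: isoZ_invKV. Qed.
Lemma isoZ_mulrV : right_inverse isoZ_one isoZ_inv isoZ_mul.
Proof. by move=> f; apply: isoZ_ext => x; apply: isoZ_invK. Qed.

HB.instance Definition _ :=
  isGroup.Build isoZ isoZ_mulA isoZ_mul1 isoZ_mulr1 isoZ_mulV isoZ_mulrV.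

(* [isoZ_ID] below views an isometry as an everywhere defined partial one. *)
Lemma isoZ_partial (f : isoZ) : partial_isometry (fun x => Some (f x)).
Proof. by move=> x y x' y' [<-] [<-]; apply: iso_dist. Qed.

Definition isoZ_ID (f : isoZ) : ID :=
  MkID (total_dom f) (total_ran (iso_bij f)) (isoZ_partial (f := f)).

Lemma isoZ_IDM : {morph isoZ_ID : f g / f * g}.
Proof. by move=> f g; apply: ID_ext. Qed.

Lemma isoZ_ID1 : isoZ_ID 1 = 1.
Proof. exact: ID_ext. Qed.

HB.instance Definition _ := isMultiplicative.Build isoZ ID isoZ_ID isoZ_IDM.
HB.instance Definition _ :=
  Multiplicative_isUMagmaMorphism.Build isoZ ID isoZ_ID isoZ_ID1.

(* Main.v *)
Require Import Defs.
From HB Require Import structures.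
From mathcomp Require Import all_boot order ssralg ssrnum ssrint.
From mathcomp Require Import boolp classical_sets functions cardinality.
From mathcomp Require Import zify.

Local Open Scope classical_set_scope.

(** Two rigidity facts carry the proof.  An isometry of the integers is
    determined by its values at two distinct points ([isoZ_eq2]), and a distance
    preserving partial map whose domain has two distinct points is the
    restriction of a translation or of a reflection ([ID_extends]).  Since a
    cofinite set of integers contains two distinct points, every partial
    cofinite isometry lies below some unit in the natural partial order, and
    the units are exactly the total isometries.

    The isomorphism is obtained from its inverse, which sends an isometry to
    its class modulo the least group congruence [isoZ_class].  This map is
    multiplicative by construction.  It is onto because comparable elements of
    an inverse semigroup are congruent ([natural_le_mg_cong]), so that each
    class contains a unit.  It is one-to-one because congruent isometries
    agree on the range of some partial cofinite isometry.  If an isometry lies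
    above [alpha], then it is congruent to [alpha], hence it is the image
    of the class of [alpha]; this gives both the formula for the natural
    homomorphism and the uniqueness of the unit above [alpha]. *)

(** If [s = t * e] and [t'] is the inverse of [t], then the idempotent
    [t * e * t'], which is the product of [s] and its inverse, carries [t] to
    [s] and fixes [s] when it multiplies them on the left. *)
Lemma natural_le_mg_cong (S : inverseSemigroupType) (s t : S) :
  natural_le s t -> mg_cong s t.
Proof.
move=> [e ee ->]; have [t' [[tt't t'tt'] _]] := inverse_uniq t.
have t't_idem : idempotent_elt (t' * t)%g by rewrite /idempotent_elt mulgA t'tt'.
have absorb : (t * e * t' * t = t * e)%g.
  by rewrite -[LHS]mulgA -[LHS]mulgA (idempotent_comm ee t't_idem) !mulgA tt't.
exists (t * e * t')%g; last by rewrite mulgA absorb -mulgA ee.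
by rewrite /idempotent_elt !mulgA absorb -[(t * e * e)%g]mulgA ee.
Qed.

Lemma cofinite_two_points (D : set int) :
  finite_set (~` D) -> exists p q, [/\ D p, D q & p <> q].
Proof.
have pick (A : set int) : finite_set A -> exists p, ~ A p.
  move=> finA; apply: contrapT => noex; apply: infinite_nat.
  (* Otherwise the absolute value maps the finite set [A] onto [nat]. *)
  have -> : [set: nat] = absz @` A.
    apply/seteqP; split=> // n _; exists (Posz n) => //.
    by apply: contrapT => nAn; apply: noex; exists (Posz n).
  exact: finite_image.
move=> finD; have [p /contrapT Dp] := pick _ finD.
have [|q nq] := pick (~` D `|` [set p]).
  by rewrite finite_setU; split=> //; exact: finite_set1.
exists p, q; split=> //; first by apply: contrapT => nDq; apply: nq; left.
by move=> pq; apply: nq; right.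
Qed.

(** The point of the line at given distances from two distinct points is
    unique. *)
Lemma isoZ_eq2 (f g : isoZ) p q :
  p <> q -> f p = g p -> f q = g q -> f = g.
Proof.
move=> pq fgp fgq; apply: isoZ_ext => x.
have := iso_dist f p q; have := iso_dist f x p; have := iso_dist f x q.
have := iso_dist g x p; have := iso_dist g x q.
by rewrite -fgp -fgq; lia.
Qed.

Lemma translation_bij (c : int) : bijective (fun x => x + c)%R.
Proof. by exists (fun x => x - c)%R => x; lia. Qed.

Lemma reflection_bij (c : int) : bijective (fun x => c - x)%R.
Proof. by exists (fun x => c - x)%R => x; lia. Qed.

Lemma translation_dist (c x y : int) : (`|(x + c) - (y + c)| = `|x - y|)%R.
Proof. by lia. Qed.

Lemma reflection_dist (c x y : int) : (`|(c - x) - (c - y)| = `|x - y|)%R.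
Proof. by lia. Qed.

Definition translation (c : int) : isoZ :=
  MkIsoZ (translation_bij c) (translation_dist c).

Definition reflection (c : int) : isoZ :=
  MkIsoZ (reflection_bij c) (reflection_dist c).

(** The sign of [alpha p - alpha q] relative to [p - q], for two distinct
    points of the domain, decides between a translation and a reflection. *)
Lemma ID_extends (alpha : ID) :
  exists f : isoZ, forall x y, alpha x = Some y -> f x = y.
Proof.
have [p [q [Dp Dq pq]]] := cofinite_two_points _ (ID_cofin_dom alpha).
rewrite /pdom /= in Dp Dq.
case ap : (alpha p) Dp => [p'|] // _; case aq : (alpha q) Dq => [q'|] // _.
have dpq := ID_isom ap aq.
have [same|opp] : (p' - q' = p - q)%R \/ (p' - q' = q - p)%R by lia.
- exists (translation (p' - p)%R) => x y axy /=.
  by have := ID_isom axy ap; have := ID_isom axy aq; lia.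
- exists (reflection (p' + p)%R) => x y axy /=.
  by have := ID_isom axy ap; have := ID_isom axy aq; lia.
Qed.

(** The idempotent witnessing the order is the partial identity of the range
    of [alpha]. *)
Lemma natural_le_isoZ (alpha : ID) (f : isoZ) :
  (forall x y, alpha x = Some y -> f x = y) -> natural_le alpha (isoZ_ID f).
Proof.
move=> af; have [beta [[aba bab] _]] := inverse_uniq alpha.
exists (beta * alpha)%g; first by rewrite /idempotent_elt mulgA bab.
have graph_ab := ID_inverse_of_graph aba.
apply: ID_ext => x; rewrite /= /ID_comp /= /ID_comp.
case ax : (alpha x) => [y|]; first by rewrite (af _ _ ax) (graph_ab _ _ ax).
case bf : (beta (f x)) => [z|] //=.
have az := ID_inverse_of_graph bab bf.
by rewrite -ax; congr (alpha _); apply: (bij_inj (iso_bij f)); rewrite (af _ _ az).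
Qed.

Lemma ID_below_isoZ (alpha : ID) : exists f : isoZ, natural_le alpha (isoZ_ID f).
Proof. by have [f af] := ID_extends alpha; exists f; apply: natural_le_isoZ. Qed.

Lemma isoZ_ID_unit (f : isoZ) : group_of_units ID (isoZ_ID f).
Proof.
by exists (isoZ_ID f^-1%g); rewrite -!isoZ_IDM mulgV mulVg isoZ_ID1.
Qed.

(** A unit is everywhere defined, so it coincides with any isometry that
    extends it. *)
Lemma unit_isoZ_ID (u : ID) : group_of_units ID u -> exists f, isoZ_ID f = u.
Proof.
move=> [v [uv1 _]]; have [f uf] := ID_extends u; exists f; apply: ID_ext => x /=.
have : (u * v)%g x = Some x by rewrite uv1.
by rewrite /= /ID_comp; case ux : (u x) => [y|] // _; rewrite (uf _ _ ux).
Qed.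

(** If [e * f = e * g], then [f] and [g] agree on the range of [e], and the
    domain of [e] has two distinct points. *)
Lemma isoZ_mg_cong_eq (f g : isoZ) : mg_cong (isoZ_ID f) (isoZ_ID g) -> f = g.
Proof.
move=> [e _ efg].
have agree x y : e x = Some y -> f y = g y.
  move=> exy; have : (e * isoZ_ID f)%g x = (e * isoZ_ID g)%g x by rewrite efg.
  by rewrite /= /ID_comp exy /= => -[].
have [p [q [Dp Dq pq]]] := cofinite_two_points _ (ID_cofin_dom e).
rewrite /pdom /= in Dp Dq.
case ep : (e p) Dp => [p'|] // _; case eq : (e q) Dq => [q'|] // _.
apply: (@isoZ_eq2 _ _ p' q'); [|exact: agree ep|exact: agree eq].
by move=> p'q'; apply: pq; apply: ID_inj ep _; rewrite p'q'.
Qed.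

Definition isoZ_class (f : isoZ) : mg_quot ID := mg_natural (isoZ_ID f).

Lemma isoZ_classM : {morph isoZ_class : f g / (f * g)%g}.
Proof. by move=> f g; rewrite /isoZ_class isoZ_IDM /mg_natural pi_mg_mul. Qed.

Lemma isoZ_class_inj : injective isoZ_class.
Proof. by move=> f g /eqP/mg_piP; apply: isoZ_mg_cong_eq. Qed.

Lemma natural_le_class (alpha : ID) (f : isoZ) :
  natural_le alpha (isoZ_ID f) -> mg_natural alpha = isoZ_class f.
Proof. by move=> le_af; apply/eqP/mg_piP; apply: natural_le_mg_cong. Qed.

Lemma isoZ_class_surj (c : mg_quot ID) : exists f, isoZ_class f == c.
Proof.
elim/quotW: c => alpha; have [f le_af] := ID_below_isoZ alpha.
by exists f; rewrite -(natural_le_class _ _ le_af).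
Qed.

Theorem mainTheorem1 :
  set_bij [set: isoZ] (group_of_units ID) isoZ_ID /\
  exists phi : {multiplicative mg_quot ID -> isoZ},
    bijective phi /\
    forall alpha : ID,
      unique (fun gamma : ID => group_of_units ID gamma /\ natural_le alpha gamma)
             (isoZ_ID (phi (mg_natural alpha))).
Proof.
split.
  split=> [f _ | f g _ _ fg | u /unit_isoZ_ID[f fu]].
  - exact: isoZ_ID_unit.
  - by apply: isoZ_class_inj; rewrite /isoZ_class fg.
  - by exists f.
pose g c := xchoose (isoZ_class_surj c).
have gK : cancel g isoZ_class by move=> c; apply/eqP/(xchooseP (isoZ_class_surj c)).
have Kg : cancel isoZ_class g by move=> f; apply: isoZ_class_inj; rewrite gK.
have gM : {morph g : c d / (c * d)%g}.
  by move=> c d; apply: isoZ_class_inj; rewrite isoZ_classM !gK.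
pose phi : {multiplicative mg_quot ID -> isoZ} :=
  HB.pack g (isMultiplicative.Build _ _ g gM).
exists phi; split; first by exists isoZ_class.
have phi_below alpha f : natural_le alpha (isoZ_ID f) -> phi (mg_natural alpha) = f.
  by move=> /natural_le_class ->; exact: Kg.
move=> alpha; split.
  split; first exact: isoZ_ID_unit.
  by have [f le_af] := ID_below_isoZ alpha; rewrite (phi_below _ _ le_af).
by move=> _ [/unit_isoZ_ID[f <-] /phi_below ->].
Qed.
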